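(* Let $A$ and $B$ be finite-dimensional quantum systems. For any finite integer $n\ge 1$, there exists no $n$-slot completely positive supermap $\mathcal{C}$ such that $\mathcal{C}(\mathcal{N}^{\otimes n})=\mathcal{N}^*$ for all quantum channels $\mathcal{N}\in\mathrm{CPTP}(A,B)$.
   Context: A quantum system $A$ is a $d_A$-dimensional complex Hilbert space $\mathcal{H}_A$ with a fixed orthonormal basis; $\mathscr{L}_A$ is the space of linear operators on $\mathcal{H}_A$. $\mathrm{CPTP}(A,B)$ is the set of quantum channels, i.e. completely positive trace-preserving linear maps $\mathscr{L}_A\to\mathscr{L}_B$. For a channel with Kraus representation $\mathcal{N}(\cdot)=\sum_j K_j(\cdot)K_j^\dagger$, its complex conjugate is $\mathcal{N}^*(\cdot)=\sum_j K_j^*(\cdot)K_j^{\mathsf T}$, where $K^*$ and $K^{\mathsf T}$ are the entrywise complex conjugate and the transpose in the fixed bases. The Choi operator of a linear map $\mathcal{N}:\mathscr{L}_A\to\mathscr{L}_B$ is $\mathsf{N}_{AB}=\sum_{i,j}|i\rangle\langle j|\otimes\mathcal{N}(|i\rangle\langle j|)$; the Choi operator of $\mathcal{N}^*$ is $\mathsf{N}_{AB}^{\mathsf T}$ (full transpose). An $n$-slot linear supermap $\mathcal{C}$ sends an $n$-tuple of linear maps $\mathcal{N}^{(i)}:\mathscr{L}_{I_i}\to\mathscr{L}_{O_i}$, $i=1,\dots,n$, multilinearly to a linear map $\mathscr{L}_P\to\mathscr{L}_F$. It is specified by a Choi operator $\mathsf{C}$ on $P I_1O_1\cdots I_nO_nF$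 (the Choi operator of an associated linear map from $PO_1\cdots O_n$ to $I_1\cdots I_nF$): the Choi operator of the output is $\mathrm{Tr}_{I_1O_1\cdots I_nO_n}\big[\mathsf{C}\,\big((\mathsf{N}^{(1)}\otimes\cdots\otimes\mathsf{N}^{(n)})^{\mathsf T}\otimes \mathbb{1}_{PF}\big)\big]$. The supermap is called completely positive if the associated linear map is completely positive, i.e. $\mathsf{C}\ge 0$. Here $I_i\cong A$, $O_i\cong B$ for all $i$, $P\cong A$, $F\cong B$, and $\mathcal{C}(\mathcal{N}^{\otimes n})$ denotes the output when every slot is filled with $\mathcal{N}$.
   Formalization: The formal theorem assumes that A has dimension at least 1 and B dimension at least 2; otherwise the claim fails, e.g. if B has dimension 1 the only channel is the trace, its own complex conjugate, and a completely positive supermap outputs it. *)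

(* Defs.v *)
From HB Require Import structures.
From mathcomp Require Import all_boot all_order all_algebra.
From mathcomp Require Import spectral.
From mathcomp Require Import reals.
From mathcomp Require Export complex.

Set Implicit Arguments.
Unset Strict Implicit.
Unset Printing Implicit Defensive.

Import Order.TTheory GRing.Theory Num.Theory Num.Def.
Local Open Scope ring_scope.
Local Open Scope sesquilinear_scope.

(* A quantum system is a finite type T whose elements label the fixed
   orthonormal basis, so the dimension is #|T|, composite systems are
   product types, and n copies of T form {ffun 'I_n -> T}. *)
Notation Op C T := 'M[C]_#|{: T}|.

Section Operators.
Variable C : numClosedFieldType.
Implicit Types S T E : finType.

Definition opmx T (f : T -> T -> C) : Op C T :=
  \matrix_(i, j) f (enum_val i) (enum_val j).

(* <s| X |t> *)
Definition entry T (X : Op C T) (s t : T) : C := X (enum_rank s) (enum_rank t).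

Definition ketbra T (s t : T) : Op C T := delta_mx (enum_rank s) (enum_rank t).

Definition tens S T (X : Op C S) (Y : Op C T) : Op C (S * T)%type :=
  opmx (fun p q => entry X p.1 q.1 * entry Y p.2 q.2).

Definition tens_pow n T (X : 'I_n -> Op C T) : Op C {ffun 'I_n -> T} :=
  opmx (fun f g : {ffun 'I_n -> T} => \prod_(i < n) entry (X i) (f i) (g i)).

(* Partial trace over the first tensor factor. *)
Definition ptrace1 S T (X : Op C (S * T)%type) : Op C T :=
  opmx (fun t t' => \sum_(s : S) entry X (s, t) (s, t')).

(* Used below only with a bijection e : S -> T that regroups tensor factors. *)
Definition relabel S T (e : S -> T) (X : Op C T) : Op C S :=
  opmx (fun s s' => entry X (e s) (e s')).

(* Over a numClosedFieldType, 0 <= z means that z is real and nonnegative. *)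
Definition psdmx m (M : 'M[C]_m) : Prop :=
  forall v : 'cV[C]_m, 0 <= (v ^t* *m M *m v) 0 0.

Lemma entry_opmx T (f : T -> T -> C) s t : entry (opmx f) s t = f s t.
Proof. by rewrite /entry mxE !enum_rankK. Qed.

Lemma op_eqP T (X Y : Op C T) :
  (forall s t, entry X s t = entry Y s t) -> X = Y.
Proof.
move=> eXY; apply/matrixP => i j.
by have := eXY (enum_val i) (enum_val j); rewrite /entry !enum_valK.
Qed.

Lemma entry_ketbra T (s t s' t' : T) :
  entry (ketbra s t) s' t' = ((s' == s) && (t' == t))%:R.
Proof. by rewrite /entry mxE !(inj_eq enum_rank_inj). Qed.

Lemma entry_sum T I (r : seq I) (P : pred I) (F : I -> Op C T) s t :
  entry (\sum_(i <- r | P i) F i) s t = \sum_(i <- r | P i) entry (F i) s t.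
Proof. by rewrite /entry summxE. Qed.

Lemma entryZD T k (X Y : Op C T) s t :
  entry (k *: X + Y) s t = k * entry X s t + entry Y s t.
Proof. by rewrite /entry !mxE. Qed.

Lemma entry_mulmx T (X Y : Op C T) s t :
  entry (X *m Y) s t = \sum_u entry X s u * entry Y u t.
Proof.
rewrite /entry mxE (reindex (@enum_rank T)) //=.
by exists enum_val => i _; rewrite ?enum_rankK ?enum_valK.
Qed.

Lemma entry1 T (s t : T) : entry (1%:M : Op C T) s t = (s == t)%:R.
Proof. by rewrite /entry mxE (inj_eq enum_rank_inj). Qed.

Lemma entry_tr T (X : Op C T) s t : entry X^T s t = entry X t s.
Proof. by rewrite /entry mxE. Qed.

End Operators.

Section Maps.
Variable C : numClosedFieldType.
Implicit Types A B E : finType.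

Definition choi A B (N : {linear Op C A -> Op C B}) : Op C (A * B)%type :=
  \sum_(i : A) \sum_(j : A) tens (ketbra C i j) (N (ketbra C i j)).

(* The linear map with Choi operator M; see of_choiK. *)
Definition of_choi A B (M : Op C (A * B)%type) (X : Op C A) : Op C B :=
  ptrace1 (M *m tens X^T 1%:M).

Lemma entry_of_choi A B (M : Op C (A * B)%type) (X : Op C A) b b' :
  entry (of_choi M X) b b' =
  \sum_a \sum_a' entry X a a' * entry M (a, b) (a', b').
Proof.
rewrite entry_opmx; apply: eq_bigr => a _; rewrite entry_mulmx.
transitivity (\sum_a' \sum_c
    entry M (a, b) (a', c) * entry (tens X^T 1%:M) (a', c) (a, b')).
  by rewrite pair_bigA; apply: eq_bigr => -[].
apply: eq_bigr => a' _.
rewrite (bigD1 b') //= [X in _ + X]big1 ?addr0.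
  by rewrite entry_opmx /= entry_tr entry1 eqxx mulr1 mulrC.
by move=> c ncb; rewrite entry_opmx /= entry1 (negPf ncb) !mulr0.
Qed.

Fact of_choi_is_linear A B (M : Op C (A * B)%type) : linear (of_choi M).
Proof.
move=> k X Y; apply: op_eqP => b b'.
rewrite entryZD !entry_of_choi.
rewrite mulr_sumr -big_split /=; apply: eq_bigr => a _.
rewrite mulr_sumr -big_split /=; apply: eq_bigr => a' _.
by rewrite entryZD mulrDl mulrA.
Qed.

HB.instance Definition _ A B (M : Op C (A * B)%type) :=
  GRing.isLinear.Build C (Op C A) (Op C B) _ (of_choi M) (of_choi_is_linear M).

Lemma entry_choi A B (N : {linear Op C A -> Op C B}) p q :
  entry (choi N) p q = entry (N (ketbra C p.1 q.1)) p.2 q.2.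
Proof.
rewrite entry_sum (bigD1 p.1) //= [X in _ + X]big1 ?addr0; last first.
  move=> i ni; rewrite entry_sum big1 // => j _.
  by rewrite entry_opmx entry_ketbra eq_sym (negPf ni) mul0r.
rewrite entry_sum (bigD1 q.1) //= [X in _ + X]big1 ?addr0; last first.
  move=> i ni; rewrite entry_opmx entry_ketbra (eq_sym q.1) (negPf ni).
  by rewrite andbF mul0r.
by rewrite entry_opmx entry_ketbra !eqxx mul1r.
Qed.

Lemma of_choiK A B (M : Op C (A * B)%type) : choi (of_choi M) = M.
Proof.
apply: op_eqP => [[a b] [a' b']]; rewrite entry_choi /= entry_of_choi.
rewrite (bigD1 a) //= [X in _ + X]big1 ?addr0; last first.
  by move=> i ni; rewrite big1 // => j _; rewrite entry_ketbra (negPf ni) mul0r.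
rewrite (bigD1 a') //= [X in _ + X]big1 ?addr0; last first.
  by move=> i ni; rewrite entry_ketbra (negPf ni) andbF mul0r.
by rewrite entry_ketbra !eqxx mul1r.
Qed.

(* (id_E (x) N)(X) *)
Definition amplify E A B (N : {linear Op C A -> Op C B})
    (X : Op C (E * A)%type) : Op C (E * B)%type :=
  \sum_(e : E) \sum_(e' : E)
    tens (ketbra C e e') (N (opmx (fun a a' => entry X (e, a) (e', a')))).

Definition completely_positive A B (N : {linear Op C A -> Op C B}) : Prop :=
  forall (E : finType) (X : Op C (E * A)%type), psdmx X -> psdmx (amplify N X).

Definition trace_preserving A B (N : {linear Op C A -> Op C B}) : Prop :=
  forall X : Op C A, \tr (N X) = \tr X.

Definition cptp A B (N : {linear Op C A -> Op C B}) : Prop :=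
  completely_positive N /\ trace_preserving N.

(* M = N^*; M does not depend on the Kraus family, see
   choi_complex_conjugate. *)
Definition complex_conjugate A B (N M : {linear Op C A -> Op C B}) : Prop :=
  exists (r : nat) (K : 'I_r -> 'M[C]_(#|{: B}|, #|{: A}|)),
    (forall X, N X = \sum_(j < r) K j *m X *m (K j) ^t*) /\
    (forall X, M X = \sum_(j < r) map_mx conjC (K j) *m X *m (K j)^T).

Lemma choi_complex_conjugate A B (N M : {linear Op C A -> Op C B}) :
  complex_conjugate N M -> choi M = (choi N)^T.
Proof.
case=> r [K [eN eM]]; apply: op_eqP => p q.
rewrite entry_tr !entry_choi eN eM !entry_sum; apply: eq_bigr => j _.
have mulE (L L' : 'M[C]_(#|{: B}|, #|{: A}|)) (a a' : A) (b b' : B) :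
    entry (L *m ketbra C a a' *m L'^T) b b'
    = L (enum_rank b) (enum_rank a) * L' (enum_rank b') (enum_rank a').
  rewrite /entry mxE (bigD1 (enum_rank a')) //= [X in _ + X]big1 ?addr0.
    rewrite !mxE (bigD1 (enum_rank a)) //= [X in _ + X]big1 ?addr0.
      by rewrite !mxE !eqxx mulr1.
    by move=> i ni; rewrite !mxE (negPf ni) mulr0.
  move=> i ni; rewrite mxE big1 ?mul0r // => k _.
  by rewrite !mxE (negPf ni) andbF mulr0.
by rewrite -map_trmx !mulE !mxE mulrC.
Qed.

End Maps.

(* When #|B| = 1 the only channel from A to B is the trace, which is its own
   conjugate, and when #|A| = 0 the only map is 0; in both cases a completely
   positive supermap N |-> N^* exists, so impossibility needs 0 < #|A| and
   1 < #|B|. *)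
Section Supermaps.
Variable C : numClosedFieldType.
Variables (n : nat) (I O P F : finType).

(* An n-slot supermap is given by its Choi operator on the factors
   I_1 O_1 ... I_n O_n P F, listed in this order. *)
Definition supermap : Type :=
  Op C ({ffun 'I_n -> I * O} * (P * F))%type.

(* Choi operator of the output:
   Tr_{I_1 O_1 ... I_n O_n} [S ((N_1 (x) ... (x) N_n)^T (x) 1_{PF})]. *)
Definition supermap_choi (S : supermap)
    (N : 'I_n -> {linear Op C I -> Op C O}) : Op C (P * F)%type :=
  ptrace1 (S *m tens (tens_pow (fun i => choi (N i)))^T 1%:M).

Definition supermap_apply (S : supermap)
    (N : 'I_n -> {linear Op C I -> Op C O}) : {linear Op C P -> Op C F} :=
  of_choi (supermap_choi S N).

Definition regroup
    (x : (P * {ffun 'I_n -> O}) * ({ffun 'I_n -> I} * F)) :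
    {ffun 'I_n -> I * O} * (P * F) :=
  ([ffun k => (x.2.1 k, x.1.2 k)], (x.1.1, x.2.2)).

(* The map from P O_1 ... O_n to I_1 ... I_n F with Choi operator S. *)
Definition associated_map (S : supermap) :
    {linear Op C (P * {ffun 'I_n -> O})%type ->
            Op C ({ffun 'I_n -> I} * F)%type} :=
  of_choi (relabel regroup S).

Definition cp_supermap (S : supermap) : Prop :=
  completely_positive (associated_map S).

End Supermaps.

(* Main.v *)
(* The supermap is tested on the channels that discard their input and prepare
   the pure state psi_y ~ |b0> + conj(y) |b1>.  Complete positivity turns the
   vanishing of <phi| psi_y^* |phi>, for phi orthogonal to the conjugate of
   psi_y, into a linear equation S (w_y (x) phi) = 0, where the n-copy vector
   w_y is polynomial in y while phi = conj(-y) |b0> + |b1> is antiholomorphic.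
   On real y both dependences are polynomial, so the equation with -y in place
   of conj(-y) persists at y = 'i; the two equations at 'i together give
   S (w_'i (x) |b1>) = 0, although <b1| psi_'i^* |b1> is nonzero. *)
Require Import Defs.
From mathcomp Require Import all_boot all_order all_algebra.
From mathcomp Require Import spectral.
From mathcomp Require Import reals complex.
From mathcomp Require Import ring.

Set Implicit Arguments.
Unset Strict Implicit.
Unset Printing Implicit Defensive.

Import Order.TTheory GRing.Theory Num.Theory Num.Def.
Local Open Scope ring_scope.
Local Open Scope sesquilinear_scope.

(** * Positive semidefinite forms, kernels and Choi operators *)

Section Positivity.
Variable C : numClosedFieldType.
Implicit Types S T A B : finType.

Lemma psdmx_ker m (M : 'M[C]_m) (v : 'cV[C]_m) :
  psdmx M -> (v ^t* *m M *m v) 0 0 = 0 -> M *m v = 0.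
Proof.
move=> psdM qv0.
pose q (u w : 'cV[C]_m) := (u ^t* *m M *m w) 0 0.
(* Replacing v by large real multiples of t *: v defeats any nonzero value. *)
have sum0 u t : t * q u v + t^* * q v u = 0.
  have pos s : 0 <= q u u + (s * q u v + s^* * q v u).
    have -> : q u u + (s * q u v + s^* * q v u) = q (u + s *: v) (u + s *: v).
      rewrite /q; have -> : (u + s *: v) ^t* = u ^t* + s^* *: v ^t*.
        by apply/matrixP => i j; rewrite !mxE rmorphD rmorphM.
      have D (X Y : 'M[C]_1) : (X + Y) 0 0 = X 0 0 + Y 0 0 by rewrite mxE.
      have Z k (X : 'M[C]_1) : (k *: X) 0 0 = k * X 0 0 by rewrite mxE.
      rewrite !mulmxDl !mulmxDr -!scalemxAl -!scalemxAr.
      by rewrite !(D, Z) qv0 !mulr0 addr0 !addrA.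
    exact: psdM.
  set x := (t * q u v + t^* * q v u).
  have quu : 0 <= q u u by exact: psdM.
  have xR : x \is Num.real.
    by rewrite -[x](addKr (q u u)) realD ?realN ?ger0_real ?pos.
  apply/eqP; apply: contraT => nx.
  pose s := - ((q u u + 1) / x).
  have sR : s^* = s.
    by apply: conj_Creal; rewrite rpredN rpred_div // rpredD ?rpred1 // ger0_real.
  have := pos (s * t); rewrite rmorphM /= sR -!mulrA -mulrDr -/x /s.
  rewrite mulNr divfK // opprD addrA subrr add0r oppr_ge0.
  by rewrite lt_geF.
(* [psdmx] does not state that [M] is Hermitian, so [q u v] and [q v u] are separated by
   polarization: [t = 1] makes their sum vanish, [t = 'i] their difference. *)
have q0 u : q u v = 0.
  have := sum0 u 1; rewrite rmorph1 !mul1r => /eqP; rewrite addr_eq0 => /eqP e1.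
  have := sum0 u 'i; rewrite conjCi e1 mulrN mulNr => /eqP.
  rewrite -opprD oppr_eq0 -mulr2n mulrn_eq0 mulf_eq0 (negPf (neq0Ci C)) /=.
  by move/eqP->; rewrite oppr0.
apply/matrixP => i j; rewrite ord1 [RHS]mxE.
have := q0 (delta_mx i 0); rewrite /q -mulmxA mxE (bigD1 i) //=.
rewrite big1 ?addr0 => [|k nk].
  by rewrite !mxE !eqxx rmorph1 mul1r.
by rewrite !mxE (negPf nk) rmorph0 mul0r.
Qed.

Definition form T (X : Op C T) (u v : T -> C) : C :=
  \sum_s \sum_t (u s)^* * (entry X s t * v t).

Definition ket T (v : T -> C) : 'cV[C]_#|{: T}| :=
  \col_i v (enum_val i).

Lemma mul_ket T (X : Op C T) v :
  X *m ket v = ket (fun s => \sum_t entry X s t * v t).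
Proof.
apply/matrixP => i j; rewrite !mxE (reindex (@enum_rank T)) /=.
  by apply: eq_bigr => t _; rewrite /entry enum_valK mxE enum_rankK.
by exists enum_val => k _; rewrite ?enum_rankK ?enum_valK.
Qed.

Lemma formE T (X : Op C T) u v : ((ket u) ^t* *m X *m ket v) 0 0 = form X u v.
Proof.
rewrite -mulmxA mul_ket mxE (reindex (@enum_rank T)) /=.
  by apply: eq_bigr => t _; rewrite !mxE enum_rankK mulr_sumr.
by exists enum_val => k _; rewrite ?enum_rankK ?enum_valK.
Qed.

Lemma psd_formP T (X : Op C T) : psdmx X <-> forall v, 0 <= form X v v.
Proof.
split=> [psdX v|pos v]; first by rewrite -formE; apply: psdX.
have -> : v = ket (fun t => v (enum_rank t) 0); last by rewrite formE.
by apply/matrixP => i j; rewrite mxE enum_valK ord1.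
Qed.

Lemma psd_form_ker T (X : Op C T) v :
  psdmx X -> form X v v = 0 -> forall s, \sum_t entry X s t * v t = 0.
Proof.
rewrite -formE => psdX /(psdmx_ker psdX) /matrixP e s.
by have := e (enum_rank s) 0; rewrite mul_ket !mxE enum_rankK.
Qed.

Lemma psd_relabel S T (e : S -> T) (X : Op C T) :
  bijective e -> psdmx (relabel e X) -> psdmx X.
Proof.
move=> be /psd_formP pos; apply/psd_formP => v.
have := pos (v \o e); rewrite /form (reindex e) /=; last exact: onW_bij.
congr (0 <= _); apply: eq_bigr => s _; rewrite [RHS](reindex e) /=; last exact: onW_bij.
by apply: eq_bigr => t _; rewrite entry_opmx.
Qed.

(** The Choi operator is the amplification of [X], the projector (up to scale) onto the maximally
    entangled vector [\sum_a |a,a>]; the form of [X] at [v] is the squared modulus of an overlap. *)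
Lemma psd_choi A B (N : {linear Op C A -> Op C B}) :
  completely_positive N -> psdmx (choi N).
Proof.
pose X : Op C (A * A)%type :=
  opmx (fun p q => (p.2 == p.1)%:R * (q.2 == q.1)%:R).
move=> /(_ A X) cpN; have -> : choi N = amplify N X.
  apply: eq_bigr => e _; apply: eq_bigr => e' _; congr (tens _ (N _)).
  by apply: op_eqP => a a'; rewrite entry_ketbra !entry_opmx -natrM mulnb.
apply: cpN; apply/psd_formP => v.
have -> : form X v v = `|\sum_(p : A * A) (p.2 == p.1)%:R * v p| ^+ 2.
  rewrite normCKC rmorph_sum mulr_suml; apply: eq_bigr => p _.
  rewrite mulr_sumr; apply: eq_bigr => q _.
  by rewrite entry_opmx rmorphM /= conjC_nat !mulrA [_^* * _]mulrC.
by rewrite exprn_ge0.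
Qed.

Lemma regroup_bij n (I O P F : finType) : bijective (@regroup n I O P F).
Proof.
exists (fun y : {ffun 'I_n -> I * O} * (P * F) =>
  ((y.2.1, [ffun k => (y.1 k).2]), ([ffun k => (y.1 k).1], y.2.2))).
  by case=> [[p o] [i f]]; rewrite /regroup /=; congr ((_, _), (_, _));
    apply/ffunP => k; rewrite !ffunE.
case=> [g [p f]]; rewrite /regroup /=; congr (_, _).
by apply/ffunP => k; rewrite !ffunE -surjective_pairing.
Qed.

Lemma psd_supermap n (I O P F : finType) (S : supermap C n I O P F) :
  cp_supermap S -> psdmx S.
Proof.
by move=> /psd_choi; rewrite of_choiK; apply: psd_relabel; apply: regroup_bij.
Qed.

End Positivity.

Lemma sum_pair (V : nmodType) (I J : finType) (F : I * J -> V) :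
  \sum_p F p = \sum_i \sum_j F (i, j).
Proof. by rewrite pair_bigA; apply: eq_bigr => -[]. Qed.

(** * Channels that discard the input and prepare a pure state *)

Section ReplacementChannel.
Variables (C : numClosedFieldType) (A B : finType) (c : C) (psi : B -> C).

(* Choi operator of X |-> \tr X *: (c *: |psi><psi|). *)
Definition repl_choi : Op C (A * B)%type :=
  opmx (fun p q => (p.1 == q.1)%:R * (c * (psi p.2 * (psi q.2)^*))).

Lemma entry_repl (X : Op C A) b b' :
  entry (of_choi repl_choi X) b b' =
  (\sum_a entry X a a) * (c * (psi b * (psi b')^*)).
Proof.
rewrite entry_of_choi mulr_suml; apply: eq_bigr => a _.
rewrite (bigD1 a) //= big1 ?addr0 => [|a' na]; rewrite entry_opmx /=.
  by rewrite eqxx mul1r.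
by rewrite eq_sym (negPf na) mul0r mulr0.
Qed.

Lemma traceE (T : finType) (X : Op C T) : \tr X = \sum_t entry X t t.
Proof.
rewrite /mxtrace (reindex (@enum_rank T)) //=.
by exists enum_val => k _; rewrite ?enum_rankK ?enum_valK.
Qed.

Lemma repl_cptp : 0 <= c -> c * \sum_b psi b * (psi b)^* = 1 ->
  cptp (of_choi repl_choi).
Proof.
move=> c0 c1; split=> [E X /psd_formP pos|X]; last first.
  rewrite !traceE -[RHS]mulr1 -c1 !mulr_sumr; apply: eq_bigr => b _.
  by rewrite entry_repl.
apply/psd_formP => v.
(* The channel has Kraus operators [|psi><a|], up to the factor [sqrt c]; [u a] is [v] after the
   adjoint [|a><psi|] on the second factor, so the output form is [c] times a sum of forms of
   [X]. *)
pose u a (p : E * A) := (p.2 == a)%:R * \sum_b (psi b)^* * v (p.1, b).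
have ampE e b e' b' : entry (amplify (of_choi repl_choi) X) (e, b) (e', b') =
    (\sum_a entry X (e, a) (e', a)) * (c * (psi b * (psi b')^*)).
  rewrite entry_sum (bigD1 e) //= [X in _ + X]big1 ?addr0; last first.
    move=> i ni; rewrite entry_sum big1 // => j _.
    by rewrite entry_opmx entry_ketbra eq_sym (negPf ni) mul0r.
  rewrite entry_sum (bigD1 e') //= [X in _ + X]big1 ?addr0; last first.
    move=> i ni; rewrite entry_opmx entry_ketbra (eq_sym e') (negPf ni).
    by rewrite andbF mul0r.
  rewrite entry_opmx entry_ketbra !eqxx mul1r entry_repl; congr (_ * _).
  by apply: eq_bigr => a _; rewrite entry_opmx.
have -> : form (amplify (of_choi repl_choi) X) v v = c * \sum_a form X (u a) (u a).
  have formX a : form X (u a) (u a) = \sum_e \sum_b \sum_e' \sum_b'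
      (v (e, b))^* * (entry X (e, a) (e', a) * (psi b * (psi b')^*) * v (e', b')).
    rewrite /form sum_pair; apply: eq_bigr => e _.
    rewrite (bigD1 a) //= [X in _ + X]big1 ?addr0; last first.
      move=> a' na; rewrite big1 // => q _.
      by rewrite /u /= (negPf na) mul0r rmorph0 mul0r.
    rewrite -mulr_sumr {1}/u /= eqxx mul1r rmorph_sum mulr_suml.
    apply: eq_bigr => b _; rewrite mulr_sumr sum_pair; apply: eq_bigr => e' _.
    rewrite (bigD1 a) //= [X in _ + X]big1 ?addr0; last first.
      by move=> a' na; rewrite /u /= (negPf na) mul0r !mulr0.
    rewrite /u /= eqxx mul1r !mulr_sumr; apply: eq_bigr => b' _.
    rewrite rmorphM /= conjCK [psi b * _]mulrC -!mulrA; congr (_ * _).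
    by rewrite mulrCA; congr (_ * _); rewrite mulrA [RHS]mulrA.
  rewrite (eq_bigr _ (fun a _ => formX a)) /form sum_pair.
  rewrite [X in _ = c * X]exchange_big mulr_sumr /=; apply: eq_bigr => e _.
  rewrite [X in _ = c * X]exchange_big mulr_sumr /=; apply: eq_bigr => b _.
  rewrite sum_pair [X in _ = c * X]exchange_big mulr_sumr /=; apply: eq_bigr => e' _.
  rewrite [X in _ = c * X]exchange_big mulr_sumr /=; apply: eq_bigr => b' _.
  rewrite ampE !mulr_suml !mulr_sumr; apply: eq_bigr => a _.
  by rewrite [RHS]mulrCA; congr (_ * _); rewrite !mulrA [c * _]mulrC.
by rewrite mulr_ge0 // sumr_ge0.
Qed.

End ReplacementChannel.

(** * A supermap evaluated on replacement channels *)

Section SupermapOnReplacement.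
Variables (C : numClosedFieldType) (n : nat) (I O P F : finType).
Variable S : supermap C n I O P F.

Definition slot_vec (eta : O -> C) (a : {ffun 'I_n -> I})
    (s : {ffun 'I_n -> I * O}) : C :=
  \prod_(k < n) (((s k).1 == a k)%:R * eta (s k).2).

Definition tensv S T (u : S -> C) (v : T -> C) (x : S * T) : C := u x.1 * v x.2.

Lemma entry_mul_tens1 (T U : finType) (X : Op C (T * U)%type) (Y : Op C T) t u t' u' :
  entry (X *m tens Y 1%:M) (t, u) (t', u') =
  \sum_r entry X (t, u) (r, u') * entry Y r t'.
Proof.
rewrite entry_mulmx sum_pair; apply: eq_bigr => r _.
rewrite (bigD1 u') //= [X in _ + X]big1 ?addr0 => [|v nv]; rewrite entry_opmx entry1 /=.
  by rewrite eqxx mulr1.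
by rewrite (negPf nv) !mulr0.
Qed.

(** The transposed Choi operator of the [n] copies is [c ^+ n] times the sum over [a] of the
    rank-one operators on [slot_vec eta a]. Preparing the conjugate of [eta] cancels the transpose,
    so [eta] enters these vectors without conjugation. *)
Lemma form_supermap_repl c (eta : O -> C) (chi : P * F -> C) :
  let N : {linear Op C I -> Op C O} :=
    of_choi (repl_choi I c (fun b => (eta b)^*)) in
  form (supermap_choi S (fun=> N)) chi chi =
  c ^+ n * \sum_a form S (tensv (slot_vec eta a) chi) (tensv (slot_vec eta a) chi).
Proof.
move=> N.
have prodE s g : entry (tens_pow (fun=> choi N))^T g s =
    c ^+ n * \sum_a (slot_vec eta a s)^* * slot_vec eta a g.
  rewrite entry_tr entry_opmx of_choiK.
  under eq_bigr => k _.
    have -> : entry (repl_choi I c (fun b => (eta b)^*)) (s k) (g k) =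
        c * \sum_i (((s k).1 == i)%:R * eta (s k).2)^* *
            (((g k).1 == i)%:R * eta (g k).2).
      rewrite entry_opmx /= conjCK (bigD1 (s k).1) //= [X in _ + X]big1 ?addr0.
        by rewrite eqxx mul1r eq_sym; ring.
      by move=> i ni; rewrite eq_sym (negPf ni) mul0r rmorph0 mul0r.
    over.
  rewrite big_split /= prodr_const card_ord bigA_distr_bigA; congr (_ * _).
  apply: eq_bigr => a _; rewrite big_split /=; congr (_ * _).
  by rewrite /slot_vec rmorph_prod.
have outE p q : entry (supermap_choi S (fun=> N)) p q =
    c ^+ n * \sum_a \sum_s \sum_g
      (slot_vec eta a s)^* * (entry S (s, p) (g, q) * slot_vec eta a g).
  rewrite entry_opmx [in RHS]exchange_big mulr_sumr; apply: eq_bigr => s _.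
  rewrite entry_mul_tens1 [X in _ = c ^+ n * X]exchange_big mulr_sumr.
  apply: eq_bigr => g _; rewrite prodE mulrCA mulr_sumr; congr (_ * _).
  by apply: eq_bigr => a _; rewrite mulrCA.
rewrite /form; under eq_bigr => p _ do under eq_bigr => q _ do
  rewrite outE -(mulrA (c ^+ n)) (mulrCA (_^*)) mulr_suml mulr_sumr.
under eq_bigr do rewrite -mulr_sumr; rewrite -mulr_sumr; congr (_ * _).
under eq_bigr do rewrite exchange_big; rewrite exchange_big; apply: eq_bigr => a _.
rewrite [RHS]sum_pair [RHS]exchange_big; apply: eq_bigr => p _ /=.
under [RHS]eq_bigr do rewrite sum_pair exchange_big; rewrite [RHS]exchange_big.
apply: eq_bigr => q _ /=; rewrite mulr_suml mulr_sumr; apply: eq_bigr => s _.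
rewrite mulr_suml mulr_sumr; apply: eq_bigr => g _.
by rewrite /tensv /=; ring.
Qed.

End SupermapOnReplacement.

(** Transposing [|psi><psi|] conjugates [psi], so each term is the squared overlap of [chi (a, _)]
    with the conjugate of [psi]. By [choi_complex_conjugate] this is the form that the conjugated
    channel must have. *)
Lemma form_repl_tr (C : numClosedFieldType) (A B : finType) c (psi : B -> C) chi :
  form (repl_choi A c psi)^T chi chi =
  c * \sum_a `|\sum_b psi b * chi (a, b)| ^+ 2.
Proof.
rewrite /form sum_pair mulr_sumr; apply: eq_bigr => a _.
rewrite normCKC rmorph_sum mulr_suml mulr_sumr; apply: eq_bigr => b _.
rewrite sum_pair (bigD1 a) //= [X in _ + X]big1 ?addr0; last first.
  move=> a' na; rewrite big1 // => b' _.
  by rewrite entry_tr entry_opmx /= (negPf na) !(mul0r, mulr0).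
rewrite !mulr_sumr; apply: eq_bigr => b' _.
by rewrite entry_tr entry_opmx eqxx /=; ring.
Qed.

(** * Continuation from the naturals, and the impossibility *)

Lemma poly_nat_roots (C : numDomainType) (q : {poly C}) :
  (forall k : nat, q.[k%:R] = 0) -> q = 0.
Proof.
move=> q0; apply: (@roots_geq_poly_eq0 _ _ [seq k%:R | k <- iota 0 (size q)]).
- by apply/allP => _ /mapP[k _ ->]; rewrite /root q0.
- by rewrite map_inj_uniq ?iota_uniq // => i j /eqP; rewrite eqr_nat => /eqP.
- by rewrite size_map size_iota.
Qed.

Lemma no_conjugation_supermap (C : numClosedFieldType) (n : nat) (A B : finType)
    (S : supermap C n A B A B) :
  (0 < #|A|)%N -> (1 < #|B|)%N -> cp_supermap S ->
  ~ forall N : {linear Op C A -> Op C B},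
      cptp N -> complex_conjugate N (supermap_apply S (fun=> N)).
Proof.
move=> /card_gt0P[p _] /card_gt1P[b0 [b1 [_ _ nb]]] /psd_supermap psdS conjS.
have nb10 : (b1 == b0) = false by rewrite eq_sym (negPf nb).
have sumB (G : B -> C) (x0 x1 : C) :
    \sum_b (if b == b0 then x0 else if b == b1 then x1 else 0) * G b =
    x0 * G b0 + x1 * G b1.
  rewrite (bigD1 b0) //= eqxx (bigD1 b1) ?nb10 //= eqxx.
  rewrite big1 ?addr0 // => b /andP[n0 n1].
  by rewrite (negPf n0) (negPf n1) mul0r.
pose eta y b : C := if b == b0 then 1 else if b == b1 then y else 0.
(* The inner product of [eta y] with [phi z] is [y^* - z], which vanishes exactly at [z = y^*]. *)
pose phi z b : C := if b == b0 then - z else if b == b1 then 1 else 0.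
pose chi z (x : A * B) : C := (x.1 == p)%:R * phi z x.2.
have conj_eta y b : (eta y b)^* = eta (y^*) b.
  by rewrite /eta; case: ifP => _; [rewrite rmorph1|case: ifP; rewrite ?rmorph0].
(* Inverse squared norm of [eta y], hence of its conjugate, the prepared state. *)
pose c (y : C) := (1 + y^* * y)^-1.
have c_gt0 y : 0 < c y.
  by rewrite invr_gt0 ltr_pwDl // mulrC mul_conjC_ge0.
(* The form of the output Choi operator at [chi z], computed through the slots on the left and from
   the conjugated channel on the right. *)
have formS y z : c y ^+ n * (\sum_a
    form S (tensv (slot_vec (eta y) a) (chi z)) (tensv (slot_vec (eta y) a) (chi z)))
    = c y * `|y^* - z| ^+ 2.
  rewrite -form_supermap_repl.
  have /conjS/choi_complex_conjugate :
      cptp (of_choi (repl_choi A (c y) (fun b => (eta y b)^*))).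
    apply: repl_cptp; first exact: ltW.
    under eq_bigr do rewrite conj_eta.
    rewrite sumB !conj_eta conjCK /eta eqxx nb10 eqxx mul1r.
    by rewrite mulVf // gt_eqF // -invr_gt0; apply: c_gt0.
  rewrite !of_choiK => ->; rewrite form_repl_tr; congr (_ * _).
  rewrite (bigD1 p) //= [X in _ + X]big1 ?addr0 => [|a na]; last first.
    by rewrite big1 ?normr0 ?expr0n // => b _; rewrite /chi /= (negPf na) mul0r mulr0.
  under eq_bigr do rewrite conj_eta /chi /= eqxx mul1r.
  by rewrite sumB /phi eqxx nb10 eqxx mul1r mulr1 addrC.
(* Only z = conj y makes phi orthogonal to psi_y^*, but T is kept as a function
   of independent y and z, in which it is polynomial. *)
pose T a s y z := \sum_t entry S s t * tensv (slot_vec (eta y) a) (chi z) t.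
(* At [z = y^*] the sum in [formS] vanishes; its terms are nonnegative, so each is zero and each
   vector lies in the kernel of [S]. *)
have T_conj a s y : T a s y (y^*) = 0.
  apply: psd_form_ker => //.
  have := formS y (y^*); rewrite subrr normr0 expr0n mulr0 => /eqP.
  rewrite mulf_eq0 expf_eq0 gt_eqF // andbF /= => /eqP.
  move/psumr_eq0P => -> // a' _.
  by move/psd_formP : psdS; apply.
have T_diag a s y : T a s y y = 0.
  pose etap b : {poly C} := if b == b0 then 1 else if b == b1 then 'X else 0.
  pose phip b : {poly C} := if b == b0 then - 'X else if b == b1 then 1 else 0.
  pose q := \sum_t (entry S s t)%:P *
    ((\prod_(k < n) (((t.1 k).1 == a k)%:R * etap (t.1 k).2)) *
     ((t.2.1 == p)%:R * phip t.2.2)).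
  have qE x : q.[x] = T a s x x.
    rewrite horner_sum; apply: eq_bigr => t _.
    have natE (b : bool) : (b%:R : {poly C}).[x] = b%:R.
      by case: b; rewrite hornerE.
    rewrite !hornerM hornerC horner_prod natE /tensv; congr (_ * (_ * (_ * _))).
      apply: eq_bigr => k _; rewrite hornerM natE /etap /eta; congr (_ * _).
      by do 2?[case: ifP => _]; rewrite !hornerE.
    by rewrite /phip /phi; do 2?[case: ifP => _]; rewrite !hornerE.
  suff q0 : q = 0 by rewrite -qE q0 horner0.
  (* Naturals are fixed by conjugation, so [T_conj] makes each of them a root of [q]. *)
  apply: poly_nat_roots => k.
  by rewrite qE -[X in T a s _ X]conjC_nat; apply: T_conj.
(* [T a s 'i z] is affine in [z] and vanishes at ['i] by [T_diag] and at [- 'i] by [T_conj], hence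
   at their midpoint [0]. *)
have T_i0 a s : T a s 'i 0 = 0.
  have TE z : T a s 'i z = T a s 'i 0 - z *
    \sum_t entry S s t * (slot_vec (eta 'i) a t.1 * ((t.2 == (p, b0))%:R)).
    rewrite mulr_sumr -sumrB; apply: eq_bigr => t _.
    rewrite /tensv /chi /phi oppr0; case: t.2 => [a' b]; rewrite xpair_eqE /=.
    by case: eqP => _; case: eqP => _ /=; ring.
  have := T_conj a s 'i; have := T_diag a s 'i.
  rewrite conjCi (TE 'i) (TE (- 'i)) mulNr opprK => /eqP; rewrite subr_eq0 => /eqP <-.
  by move/eqP; rewrite -mulr2n mulrn_eq0 => /eqP.
(* Here the left side of [formS] is zero, while the right side is [c 'i], which is positive. *)
have := formS 'i 0; rewrite big1 => [|a _]; last first.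
  rewrite /form big1 // => s _; rewrite -mulr_sumr.
  by rewrite [X in _ * X](T_i0 a s) mulr0.
rewrite mulr0 subr0 norm_conjC normCi expr1n mulr1 => /eqP.
by rewrite eq_sym gt_eqF.
Qed.

Theorem theorem1 (R : realType) (A B : finType) (n : nat)
    (hA : (0 < #|A|)%N) (hB : (1 < #|B|)%N) (hn : (1 <= n)%N) :
  ~ exists S : supermap R[i] n A B A B,
      cp_supermap S /\
      forall N : {linear Op R[i] A -> Op R[i] B},
        cptp N -> complex_conjugate N (supermap_apply S (fun _ : 'I_n => N)).
Proof. by case=> S [cpS]; apply: no_conjugation_supermap. Qed.
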